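(* Let $\mathcal{M}$ be an ergodic (not necessarily reversible) Markov chain on a finite state space $\Omega$ with stationary distribution $\pi$, and let $\mathcal{M}'$ be a reversible ergodic Markov chain on $\Omega$ with the same stationary distribution. Let $f$ be an $(\mathcal{M},\mathcal{M}')$-flow. Then for every $\varepsilon>0$ and $x\in\Omega$, $$\tau_x(\widetilde{\mathcal{M}},\varepsilon)\ \le\ \frac{A(f)}{2}\left[\tau\Big(\mathcal{M}',\frac{1}{2e}\Big)+1\right]\ln\left(\frac{1}{\varepsilon^2\pi(x)}\right).$$
   Context: A (discrete-time) Markov chain on a finite state space $\Omega$ with transition matrix $P$ is ergodic if irreducible and aperiodic; it then has a unique stationary distribution $\pi>0$; reversible means $\pi(x)P(x,y)=\pi(y)P(y,x)$. Variation distance: $\|\theta_1-\theta_2\|=\frac12\sum_i|\theta_1(i)-\theta_2(i)|$. Discrete mixing time: $\tau_x(\mathcal{M},\varepsilon)=\min\{t>0 \text{ integer}: \|P^{t'}(x,\cdot)-\pi\|\le\varepsilon \ \forall t'\ge t\}$, $\tau(\mathcal{M},\varepsilon)=\max_x\tau_x(\mathcal{M},\varepsilon)$. Continuization $\widetilde{\mathcal{M}}$: with $Q=P-I$, time-$t$ transition matrix $\exp(Qt)$; $\tau_x(\widetilde{\mathcal{M}},\varepsilon)=\inf\{t>0: \|v_x\exp(Qt')-\pi\|\le\varepsilon \ \forall \text{ real } t'\ge t\}$ ($v_x$ the unit row vector at $x$). Flows: Let $\mathcal{M}$ have transition matrix $P$ and stationary distribution $\pi$, and $\mathcal{M}'$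 have transition matrix $P'$ and stationary distribution $\pi'$. Let $E^*(\mathcal{M})=\{(x,y): P(x,y)>0\}$ (pairs not necessarily distinct), similarly $E^*(\mathcal{M}')$. For $(x,y)\in E^*(\mathcal{M}')$, $\mathcal{P}_{x,y}$ is the set of paths $\gamma=(x=x_0,\dots,x_k=y)$ with each $(x_i,x_{i+1})\in E^*(\mathcal{M})$ and each $(z,w)\in E^*(\mathcal{M})$ appearing at most twice as a consecutive pair on $\gamma$; $|\gamma|=k$. $\mathcal{P}=\bigcup_{(x,y)\in E^*(\mathcal{M}')}\mathcal{P}_{x,y}$. An $(\mathcal{M},\mathcal{M}')$-flow is $f:\mathcal{P}\to[0,1]$ with $\sum_{\gamma\in\mathcal{P}_{x,y}}f(\gamma)=\pi'(x)P'(x,y)$ for all $(x,y)\in E^*(\mathcal{M}')$. With $r((z,w),\gamma)$ the number of times $(z,w)$ appears on $\gamma$, $A_{z,w}(f)=\frac{1}{\pi(z)P(z,w)}\sum_{\gamma:(z,w)\in\gamma}r((z,w),\gamma)|\gamma|f(\gamma)$ and $A(f)=\max_{(z,w)\in E^*(\mathcal{M})}A_{z,w}(f)$.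
   Formalization: The bound is proved under the added assumption ε²π(x) ≤ 1, which covers all ε ≤ 1; for ε²π(x) > 1 it fails on any state space with at least two states, since then τ_x = 0 while A(f) > 0 and the logarithm is negative. *)

(* Defs.v *)
From HB Require Import structures.
From mathcomp Require Import all_boot all_order all_algebra.
From mathcomp Require Import all_classical all_reals all_analysis.
Set Implicit Arguments. Unset Strict Implicit. Unset Printing Implicit Defensive.
Import Order.TTheory GRing.Theory Num.Theory numFieldNormedType.Exports.
Local Open Scope ring_scope.
Local Open Scope classical_set_scope.

Section MarkovDefs.
Variables (R : realType) (n : nat).
Local Notation N := n.+1.
Local Notation S := 'I_N.
Implicit Types (P : 'M[R]_N) (pi : 'rV[R]_N).

Definition stochastic P :=
  (forall x y, 0 <= P x y) /\ (forall x, \sum_y P x y = 1).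

Definition irreducible P := forall x y : S, exists t : nat, 0 < (P ^+ t) x y.

Definition aperiodic P :=
  forall x : S, forall d : nat,
    (forall t : nat, (0 < t)%N -> 0 < (P ^+ t) x x -> (d %| t)%N) -> d = 1%N.

Definition ergodic P := [/\ stochastic P, irreducible P & aperiodic P].

Definition stationary P pi :=
  [/\ forall x, 0 <= pi 0 x, \sum_x pi 0 x = 1 & pi *m P = pi].

Definition reversible P pi := forall x y, pi 0 x * P x y = pi 0 y * P y x.

Definition tvd (mu nu : 'rV[R]_N) : R := 2^-1 * \sum_i `|mu 0 i - nu 0 i|.

Definition tau_x P pi (x : S) (eps : R) : R :=
  inf ((fun t : nat => t%:R) @`
        [set t : nat | (0 < t)%N /\
           forall t' : nat, (t <= t')%N -> tvd (row x (P ^+ t')) pi <= eps]).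

Definition tau P pi (eps : R) : R := \big[Num.max/0]_(x : S) tau_x P pi x eps.

Definition mexp (A : 'M[R]_N) : 'M[R]_N :=
  \matrix_(i, j) limn (series ((fun k : nat => (A ^+ k) i j / (k`!)%:R) : R^nat)).

(* continuization: Q = P - I, time-t transition matrix exp(Q t) *)
Definition ctau_x P pi (x : S) (eps : R) : R :=
  inf [set t : R | 0 < t /\
         forall t' : R, t <= t' ->
           tvd (row x (mexp (t' *: (P - 1%:M)))) pi <= eps].

Definition path_edges (g : seq S) : seq (S * S) := zip g (behead g).

Definition path_len (g : seq S) : nat := (size g).-1.

Definition occ (e : S * S) (g : seq S) : nat := count_mem e (path_edges g).

Definition is_path P (x y : S) (g : seq S) : bool :=
  if g is x0 :: p then
    [&& x0 == x, last x0 p == y,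
        all (fun e : S * S => 0 < P e.1 e.2) (path_edges g) &
        all (fun e : S * S => (occ e g <= 2)%N) (path_edges g)]
  else false.

(* every path of P has at most 2 |E*(M)| <= 2 N^2 edges; hence summing over
   tuples of at most 2 N^2 + 1 states enumerates all such paths exactly once *)
Definition max_nverts : nat := (2 * N * N).+2.

Definition sum_paths (Q : seq S -> bool) (F : seq S -> R) : R :=
  \sum_(k < max_nverts) \sum_(t : k.-tuple S | Q (tval t)) F (tval t).

Definition in_paths P P' (g : seq S) : bool :=
  [exists x : S, exists y : S, (0 < P' x y) && is_path P x y g].

Definition is_flow P P' pi (f : seq S -> R) :=
  (forall g, in_paths P P' g -> 0 <= f g <= 1) /\
  (forall x y : S, 0 < P' x y ->
     sum_paths (is_path P x y) f = pi 0 x * P' x y).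

Definition congestion_edge P P' pi (f : seq S -> R) (e : S * S) : R :=
  (pi 0 e.1 * P e.1 e.2)^-1 *
  sum_paths (in_paths P P')
    (fun g => (occ e g)%:R * (path_len g)%:R * f g).

(* A(f): max over (z,w) in E*(M) (all A_{z,w} are >= 0, E*(M) nonempty) *)
Definition congestion P P' pi (f : seq S -> R) : R :=
  \big[Num.max/0]_(e : S * S | 0 < P e.1 e.2) congestion_edge P P' pi f e.

End MarkovDefs.

(* Main.v *)
(* Write g_t = (mu_t - pi) / pi for the density of mu_t = v_x exp(Qt) relative to
   pi. Then d/dt |g_t|^2 = - D_P(g_t), where |.| is the norm of L^2(pi) and
   D_P(u) = sum pi(x) P(x,y) (u(x) - u(y))^2, and 4 tvd^2 <= |g_t|^2 by
   Cauchy-Schwarz, so it suffices to prove 2 |u|^2 <= A(f) (tau' + 1) D_P(u)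
   for u of mean 0. Telescoping along paths gives D_P' <= A(f) D_P.
   For 2 |u|^2 <= (tau' + 1) D_P'(u) no spectral theorem is needed: with
   b_j = |P'^j u|^2, self-adjointness makes b log-convex, hence
   b_k >= (b_1 / b_0)^k b_0, while the definition of tau' gives
   b_(k tau') = O(e^(-2k)). So (b_1 / b_0)^tau' <= e^(-2), which forces
   b_1 / b_0 <= (tau' / (tau' + 1))^2, and Cauchy-Schwarz bounds <u, P' u>.
   That tau' is an attained infimum requires convergence of P', obtained from
   an L^1 contraction of a strictly positive power. *)
Require Import Defs.
From HB Require Import structures.
From mathcomp Require Import all_boot all_order all_algebra.
From mathcomp Require Import all_classical all_reals all_analysis.
From mathcomp Require Import ring lra.
Import Order.TTheory GRing.Theory Num.Theory numFieldNormedType.Exports.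
Local Open Scope ring_scope.

(** Lagrange's identity: the right side minus the left is half the double sum of
    [w i * w j * (a i * b j - a j * b i) ^+ 2]. *)
Lemma sqr_sum_le (R : realDomainType) (I : Type) (s : seq I) (w a b : I -> R) :
  (forall i, 0 <= w i) ->
  (\sum_(i <- s) w i * a i * b i) ^+ 2 <=
  (\sum_(i <- s) w i * a i ^+ 2) * (\sum_(i <- s) w i * b i ^+ 2).
Proof.
move=> w_ge0; set A := \sum_(i <- s) w i * a i ^+ 2.
set B := \sum_(i <- s) w i * b i ^+ 2; set C := \sum_(i <- s) _.
have : 0 <= \sum_(i <- s) \sum_(j <- s) w i * w j * (a i * b j - a j * b i) ^+ 2.
  apply: sumr_ge0 => i _; apply: sumr_ge0 => j _.
  exact: mulr_ge0 (mulr_ge0 (w_ge0 i) (w_ge0 j)) (sqr_ge0 _).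
suff -> : \sum_(i <- s) \sum_(j <- s) w i * w j * (a i * b j - a j * b i) ^+ 2 =
  A * B + B * A - 2 * (C * C) by rewrite expr2; lra.
rewrite !big_distrlr !mulr_sumr -!big_split -sumrB; apply: eq_bigr => i _ /=.
rewrite mulr_sumr -!big_split -sumrB; apply: eq_bigr => j _ /=; ring.
Qed.

(** * Positivity and convergence of powers of a chain *)

Section Chain.
Variables (R : realType) (n : nat).
Implicit Types (P : 'M[R]_n.+1) (pi : 'rV[R]_n.+1).

Lemma stationary_expr P pi t : stationary P pi -> pi *m P ^+ t = pi.
Proof.
case=> _ _ piP; elim: t => [|t IH]; first by rewrite expr0 mulmx1.
by rewrite exprS -mulmxE mulmxA piP.
Qed.

Lemma stochastic_expr P t : stochastic P -> stochastic (P ^+ t).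
Proof.
case=> P0 P1; elim: t => [|t [Pt0 Pt1]].
  split=> [x y|x]; rewrite expr0.
    by rewrite mxE; case: (x == y).
  under eq_bigr do rewrite mxE.
  by rewrite (bigD1 x) //= eqxx big1 ?addr0 // => y /negPf; rewrite eq_sym => ->.
split=> [x y|x]; rewrite exprS -mulmxE.
  by rewrite mxE sumr_ge0 // => z _; rewrite mulr_ge0.
under eq_bigr do rewrite mxE.
rewrite exchange_big /= -[RHS](P1 x); apply: eq_bigr => y _.
by rewrite -mulr_sumr Pt1 mulr1.
Qed.

(** A zero of pi at x spreads backwards: 0 = pi(x) = sum_y pi(y) P^t(y,x), and every y has some t
    with P^t(y,x) > 0. Then pi vanishes, against total mass 1. *)
Lemma stationary_gt0 P pi x : ergodic P -> stationary P pi -> 0 < pi 0 x.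
Proof.
move=> [stP irrP _] st; have [pi0 pi1 _] := st.
rewrite lt_neqAle pi0 andbT eq_sym; apply/eqP => pix0.
have pi_all0 y : pi 0 y = 0.
  have [t Pt] := irrP y x; have [Pt0 _] := stochastic_expr P t stP.
  have := congr1 (fun v : 'rV[R]_n.+1 => v 0 x) (stationary_expr P pi t st).
  rewrite mxE pix0 => /eqP; rewrite psumr_eq0 => [|z _]; last by rewrite mulr_ge0.
  move/allP/(_ y); rewrite mem_index_enum => /(_ isT) /=.
  by rewrite mulf_eq0 (gt_eqF Pt) orbF => /eqP.
by move: pi1; rewrite big1 // => /esym/eqP; rewrite oner_eq0.
Qed.

Lemma expr_entry_gt0 P s t x y z : stochastic P ->
  0 < (P ^+ s) x y -> 0 < (P ^+ t) y z -> 0 < (P ^+ (s + t)) x z.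
Proof.
move=> stP Ps Pt; rewrite exprD -mulmxE mxE (bigD1 y) //=.
have [Ps0 _] := stochastic_expr P s stP; have [Pt0 _] := stochastic_expr P t stP.
by rewrite ltr_pwDl ?mulr_gt0 // sumr_ge0 // => u _; rewrite mulr_ge0.
Qed.

(* Reversibility makes 2 a return time, so aperiodicity amounts to the
   existence of an odd one. *)
Lemma reversible_expr_gt0 P pi : ergodic P -> stationary P pi -> reversible P pi ->
  exists m, forall x y, 0 < (P ^+ m) x y.
Proof.
move=> ergP stP rev; have [stoP irr aper] := ergP; have [P0 P1] := stoP.
have ret2 x : 0 < (P ^+ 2) x x.
  have [y Pxy] : exists y, 0 < P x y.
    have : \sum_y P x y <> 0 by rewrite P1; apply/eqP/oner_neq0.
    move=> sumN0; apply/existsP; rewrite -[X in is_true X]negbK; apply/negP => /existsPn Px.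
    by apply: sumN0; apply: big1 => y _; apply/eqP; rewrite eq_le P0 andbT leNgt Px.
  have Pyx : 0 < P y x.
    rewrite -(pmulr_rgt0 _ (stationary_gt0 P pi y ergP stP)) -rev.
    by rewrite mulr_gt0 // (stationary_gt0 P pi x ergP stP).
  by rewrite -[2%N]/(1 + 1)%N; apply: (expr_entry_gt0 _ _ _ x y x); rewrite ?expr1.
have even_ret x k : 0 < (P ^+ (k.*2)) x x.
  elim: k => [|k IH]; first by rewrite expr0 mxE eqxx ltr01.
  by rewrite doubleS -add2n; apply: (expr_entry_gt0 _ _ _ x x x).
have odd_ret x : exists2 t, odd t & 0 < (P ^+ t) x x.
  apply: contrapT => no_odd; have := aper x 2; suff H : forall t : nat,
    (0 < t)%N -> 0 < (P ^+ t) x x -> (2 %| t)%N by move/(_ H).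
  move=> t t0 Pt; rewrite dvdn2; apply/negP => odd_t; apply: no_odd; by exists t.
(* Loop at x for [t - s] steps, spending the odd return time [q] when that number is odd, then reach
   y in [s] steps. *)
have eventually_gt0 x y : exists m : nat, forall t : nat, (m <= t)%N -> 0 < (P ^+ t) x y.
  have [s Ps] := irr x y; have [q odd_q Pq] := odd_ret x.
  exists (s + q)%N => t le_t; rewrite -(@subnK s t) ?(leq_trans _ le_t) ?leq_addr //.
  apply: (expr_entry_gt0 _ _ _ x x y) => //.
  have le_q : (q <= t - s)%N by rewrite leq_subRL ?(leq_trans _ le_t) ?leq_addr.
  case odd_ts : (odd (t - s)).
    rewrite -(subnK le_q); apply: (expr_entry_gt0 _ _ _ x x x) => //.
    by rewrite -[(_ - q)%N]odd_double_half oddB // odd_ts odd_q add0n.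
  by rewrite -[(t - s)%N]odd_double_half odd_ts add0n.
have [m Pm] := choice (fun xy : 'I_n.+1 * 'I_n.+1 => eventually_gt0 xy.1 xy.2).
exists (\max_xy m xy) => x y; apply: (Pm (x, y)); exact: leq_bigmax.
Qed.

(** Doeblin's argument: as [v] has total mass 0, subtracting [d] from all entries of [M] leaves
    [v *m M] unchanged, and what remains is nonnegative with row sums 1 - N d. *)
Lemma l1_contract (M : 'M[R]_n.+1) (d : R) (v : 'rV[R]_n.+1) : stochastic M ->
  (forall x y, d <= M x y) -> \sum_x v 0 x = 0 ->
  \sum_y `|(v *m M) 0 y| <= (1 - n.+1%:R * d) * \sum_x `|v 0 x|.
Proof.
move=> [_ M1] dM v0.
have -> : (1 - n.+1%:R * d) * \sum_x `|v 0 x| = \sum_y \sum_x `|v 0 x| * (M x y - d).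
  rewrite exchange_big /= mulr_sumr; apply: eq_bigr => x _.
  by rewrite -mulr_sumr sumrB M1 sumr_const card_ord mulrC mulr_natl.
apply: ler_sum => y _.
have -> : (v *m M) 0 y = \sum_x v 0 x * (M x y - d).
  rewrite mxE [RHS](eq_bigr (fun x => v 0 x * M x y - v 0 x * d)) => [|x _]; last by rewrite mulrBr.
  by rewrite sumrB -mulr_suml v0 mul0r subr0.
apply: le_trans (ler_norm_sum _ _ _) _; apply: ler_sum => x _.
by rewrite normrM [`|M x y - d|]ger0_norm ?subr_ge0.
Qed.

Lemma l1_expr_le P m (q : R) (v : 'rV[R]_n.+1) : 0 <= q ->
  (forall w : 'rV[R]_n.+1, \sum_x w 0 x = 0 ->
     \sum_y `|(w *m P ^+ m) 0 y| <= q * \sum_x `|w 0 x|) ->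
  stochastic P -> \sum_x v 0 x = 0 ->
  forall k, \sum_y `|(v *m P ^+ (k * m)) 0 y| <= q ^+ k * \sum_x `|v 0 x|.
Proof.
move=> q0 contr stP v0 k.
have sum0 t : \sum_y (v *m P ^+ t) 0 y = 0.
  have [_ Pt1] := stochastic_expr P t stP.
  under eq_bigr do rewrite mxE.
  rewrite exchange_big /= -[RHS]v0; apply: eq_bigr => x _.
  by rewrite -mulr_sumr Pt1 mulr1.
elim: k => [|k IH]; first by rewrite !expr0 mulmx1 mul1r.
rewrite mulSnr exprD -mulmxE mulmxA; apply: le_trans (contr _ (sum0 _)) _.
by rewrite exprS -mulrA ler_wpM2l.
Qed.

(** Ensures that the set whose infimum is [tau_x] is nonempty; an empty one would have infimum 0 by
    default. *)
Lemma reversible_mixing P pi (eps : R) : ergodic P -> stationary P pi ->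
  reversible P pi -> 0 < eps -> forall x, exists2 t : nat, (0 < t)%N &
    forall t' : nat, (t <= t')%N -> tvd (row x (P ^+ t')) pi <= eps.
Proof.
move=> ergP stP rev eps0 x; have [stoP _ _] := ergP; have [_ pi1 _] := stP.
have [m Pm] := reversible_expr_gt0 P pi ergP stP rev.
have stoPm := stochastic_expr P m stoP.
pose d := \big[Num.min/1]_(xy : 'I_n.+1 * 'I_n.+1) (P ^+ m) xy.1 xy.2.
have d0 : 0 < d by apply: lt_bigmin => [|xy _]; rewrite ?ltr01.
have dle y z : d <= (P ^+ m) y z by apply: (bigmin_le _ (y, z)).
pose q := 1 - n.+1%:R * d.
have q0 : 0 <= q.
  rewrite subr_ge0.
  have -> : n.+1%:R * d = \sum_(y < n.+1) d by rewrite sumr_const card_ord mulr_natl.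
  have [_ /(_ x) <-] := stoPm.
  by apply: ler_sum => y _; apply: dle.
have q1 : q < 1 by rewrite ltrBlDr ltrDl mulr_gt0 // ltr0n.
pose v := row x 1%:M - pi.
have v0 : \sum_y v 0 y = 0.
  under eq_bigr do rewrite !mxE.
  by rewrite sumrB pi1 (bigD1 x) //= eqxx big1 ?addr0 ?subrr // => y /negPf; rewrite eq_sym => ->.
have vE t : row x (P ^+ t) - pi = v *m P ^+ t.
  by rewrite mulmxBl (stationary_expr P pi t stP) -row_mul mul1mx.
have tvdE t : tvd (row x (P ^+ t)) pi = 2^-1 * \sum_y `|(v *m P ^+ t) 0 y|.
  by congr (_ * _); apply: eq_bigr => y _; rewrite -vE !mxE.
have [k qk] : exists k, q ^+ k * \sum_y `|v 0 y| <= eps.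
  have : ((fun k => q ^+ k * \sum_y `|v 0 y|) @ \oo --> 0)%classic.
    rewrite -[X in (_ --> X)%classic](mul0r (\sum_y `|v 0 y|)).
    apply: cvgMr_tmp; apply: cvg_expr; by rewrite ger0_norm.
  move=> /cvgr0_norm_le /(_ _ eps0) [k _ /(_ k (leqnn k)) /=] H.
  by exists k; apply: le_trans H; rewrite ler_norm.
(* With lower bound 0, contraction says that one step never increases the L^1 norm; this covers all
   times after [k * m]. *)
have contr1 := l1_contract P 0 _ stoP (fst stoP).
have nonincr t : \sum_y `|(v *m P ^+ (k * m + t)) 0 y| <= eps.
  apply: le_trans qk; elim: t => [|t IH].
    rewrite addn0; apply: l1_expr_le => // w; exact: l1_contract.
  rewrite addnS exprSr -mulmxE mulmxA; apply: le_trans IH.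
  apply: le_trans (contr1 _ _) _; last by rewrite mulr0 subr0 mul1r.
  by rewrite -vE; under eq_bigr do rewrite !mxE; rewrite sumrB pi1
    (snd (stochastic_expr P _ stoP)) subrr.
(* The successor secures a positive time, as [k * m] may be 0. *)
exists (k * m).+1 => // t' lt_t'; rewrite tvdE -(subnKC (ltnW lt_t')).
rewrite mulrC ler_pdivrMr ?ltr0n //; apply: le_trans (nonincr _) _.
by rewrite ler_peMr ?ler1n // ltW.
Qed.

(** A nonempty set of naturals contains its infimum. The largest of the minimal times serves every
    start, since the condition in [tau_x] covers all later times. *)
Lemma tau_attained P pi (eps : R) :
  (forall x, exists2 t : nat, (0 < t)%N &
     forall t' : nat, (t <= t')%N -> tvd (row x (P ^+ t')) pi <= eps) ->
  exists2 t : nat, t%:R <= tau P pi eps &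
    forall x, tvd (row x (P ^+ t)) pi <= eps.
Proof.
move=> mixing.
have /choice[t_ t_P] : forall x, exists t : nat, t%:R <= tau_x P pi x eps /\
    forall t' : nat, (t <= t')%N -> tvd (row x (P ^+ t')) pi <= eps.
  move=> x; pose good (t : nat) := `[< (0 < t)%N /\ forall t' : nat, (t <= t')%N ->
    tvd (row x (P ^+ t')) pi <= eps >].
  have exgood : exists t, good t by have [t t0 Ht] := mixing x; exists t; apply/asboolP.
  case: (ex_minnP exgood) => t /asboolP[t0 Ht] tmin; exists t; split=> //.
  apply: lb_le_inf; first by exists t%:R, t.
  by move=> _ [s Hs <-]; rewrite ler_nat; apply: tmin; apply/asboolP.
exists (\max_x t_ x).
  have [|x ->] := @bigop.eq_bigmax _ t_; first by rewrite card_ord.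
  exact: le_trans (proj1 (t_P x)) (le_bigmax _ _ _).
by move=> x; apply: (proj2 (t_P x)); apply: leq_bigmax.
Qed.

(** * The inner product of L^2(pi) and the Dirichlet form *)

Definition dotpi pi (u v : 'cV[R]_n.+1) := \sum_x pi 0 x * u x 0 * v x 0.

(* Twice the usual Dirichlet form. *)
Definition dirichlet P pi (u : 'cV[R]_n.+1) :=
  \sum_x \sum_y pi 0 x * P x y * (u x 0 - u y 0) ^+ 2.

Lemma dotpi_ge0 pi u : (forall x, 0 <= pi 0 x) -> 0 <= dotpi pi u u.
Proof.
move=> pi0; apply: sumr_ge0 => x _.
by rewrite -mulrA -expr2 mulr_ge0 ?sqr_ge0.
Qed.

Lemma dotpi_CS pi u v : (forall x, 0 <= pi 0 x) ->
  dotpi pi u v ^+ 2 <= dotpi pi u u * dotpi pi v v.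
Proof.
move=> pi0.
have sq w : dotpi pi w w = \sum_x pi 0 x * w x 0 ^+ 2.
  by apply: eq_bigr => x _; rewrite -mulrA -expr2.
rewrite !sq; exact: (sqr_sum_le R _ _ (pi 0) (u^~ 0) (v^~ 0)).
Qed.

Lemma dotpi_self_adjoint P pi u v : reversible P pi ->
  dotpi pi (P *m u) v = dotpi pi u (P *m v).
Proof.
move=> rev; rewrite /dotpi.
under eq_bigr do rewrite mxE mulr_sumr mulr_suml.
under [RHS]eq_bigr do rewrite mxE mulr_sumr.
rewrite exchange_big /=; apply: eq_bigr => y _; apply: eq_bigr => x _.
by rewrite mulrA rev; ring.
Qed.

Lemma dirichlet_ge0 P pi u : stochastic P -> (forall x, 0 <= pi 0 x) ->
  0 <= dirichlet P pi u.
Proof.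
move=> [P0 _] pi0; apply: sumr_ge0 => x _; apply: sumr_ge0 => y _.
by apply: mulr_ge0 (sqr_ge0 _); rewrite mulr_ge0.
Qed.

(** Expanding the square, the diagonal terms both give |u|^2: one by the row sums of [P], the other
    by stationarity. It will serve both chains. *)
Lemma dirichletE P pi u : stochastic P -> stationary P pi ->
  dirichlet P pi u = 2 * (dotpi pi u u - dotpi pi u (P *m u)).
Proof.
move=> [_ P1] [_ _ piP].
have uu : dotpi pi u u = \sum_x \sum_y pi 0 x * P x y * (u x 0 * u x 0).
  apply: eq_bigr => x _; rewrite -mulr_suml -mulr_sumr P1; ring.
have uu' : dotpi pi u u = \sum_x \sum_y pi 0 x * P x y * (u y 0 * u y 0).
  rewrite exchange_big /=; apply: eq_bigr => y _.
  by rewrite -mulr_suml -[in LHS]piP mxE mulrA.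
have uPu : dotpi pi u (P *m u) = \sum_x \sum_y pi 0 x * P x y * (u x 0 * u y 0).
  apply: eq_bigr => x _; rewrite mxE mulr_sumr; apply: eq_bigr => y _; ring.
rewrite mulrBr mulr_natl mulr2n {1}uu uu' uPu mulr_sumr -big_split -sumrB.
apply: eq_bigr => x _; rewrite /= mulr_sumr -big_split -sumrB.
by apply: eq_bigr => y _ /=; ring.
Qed.

Lemma mean0_expr P pi t (u : 'cV[R]_n.+1) : stationary P pi ->
  pi *m u = 0 -> pi *m (P ^+ t *m u) = 0.
Proof. by move=> stP u0; rewrite mulmxA (stationary_expr P pi t stP). Qed.

(** Since [u] has mean 0, pi may be subtracted from each row of [P ^+ t]; the difference has L^1
    norm at most [c], twice its variation distance bound. *)
Lemma sup_contract P pi t (u : 'cV[R]_n.+1) (c M : R) :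
  (forall x, tvd (row x (P ^+ t)) pi <= c / 2) ->
  pi *m u = 0 -> (forall x, `|u x 0| <= M) ->
  forall x, `|(P ^+ t *m u) x 0| <= c * M.
Proof.
move=> mix u0 uM x.
have M0 : 0 <= M := le_trans (normr_ge0 _) (uM x).
have -> : (P ^+ t *m u) x 0 = \sum_y ((P ^+ t) x y - pi 0 y) * u y 0.
  have piu0 : \sum_y pi 0 y * u y 0 = 0 by move/matrixP/(_ 0 0): u0; rewrite !mxE.
  rewrite mxE -[LHS]subr0 -[X in _ - X = _]piu0 -sumrB.
  by apply: eq_bigr => y _; rewrite mulrBl.
apply: le_trans (ler_norm_sum _ _ _) _.
have : \sum_y `|row x (P ^+ t) 0 y - pi 0 y| <= c.
  by move: (mix x); rewrite /tvd mulrC ler_pM2r ?invr_gt0 ?ltr0n.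
move/(ler_wpM2r M0); apply: le_trans; rewrite mulr_suml; apply: ler_sum => y _.
by rewrite mxE normrM ler_wpM2l.
Qed.

End Chain.

(** * A Poincare inequality from the discrete mixing time *)

Lemma log_convex_growth (R : realFieldType) (b : nat -> R) :
  (forall j, 0 <= b j) -> (forall j, b j.+1 ^+ 2 <= b j * b j.+2) ->
  forall k, b 1%N ^+ k * b 0%N <= b 0%N ^+ k * b k.
Proof.
move=> b0 lc.
(* Monotonicity of the ratios b_(j+1) / b_j, cross-multiplied because [b j] may vanish;
   log-convexity then forces [b j.+1] to vanish too. *)
have step j : b 1%N * b j <= b 0%N * b j.+1.
  elim: j => [|j IH]; first by rewrite mulrC.
  have := lc j; have := b0 j; rewrite le_eqVlt => /predU1P[<-|bj].
    rewrite mul0r => bj1; have -> : b j.+1 = 0.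
      by apply/eqP; rewrite -sqrf_eq0 eq_le bj1 sqr_ge0.
    by rewrite mulr0 mulr_ge0.
  move=> lcj; rewrite -(ler_pM2l bj).
  apply: (@le_trans _ _ (b 0%N * b j.+1 ^+ 2)).
    by rewrite expr2 !mulrA ler_wpM2r // mulrC.
  by rewrite [leRHS]mulrCA ler_wpM2l.
elim=> [|k IH]; first by rewrite !expr0.
rewrite exprS -mulrA; apply: le_trans (ler_wpM2l (b0 1%N) IH) _.
by rewrite mulrCA exprSr -mulrA ler_wpM2l ?exprn_ge0.
Qed.

(** If s < r, then C (s/r)^k tends to 0 while staying at least [c]. This removes multiplicative
    constants from a comparison of rates. *)
Lemma geometric_rate_le (R : realType) (r s c C : R) : 0 < c -> 0 < s ->
  (forall k : nat, r ^+ k * c <= C * s ^+ k) -> r <= s.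
Proof.
move=> c0 s0 H; rewrite leNgt; apply/negP => sr.
have r0 := lt_trans s0 sr.
have : ((fun k => (s / r) ^+ k * C) @ \oo --> 0)%classic.
  rewrite -[X in (_ --> X)%classic](mul0r C); apply: cvgMr_tmp; apply: cvg_expr.
  by rewrite ger0_norm ?divr_ge0 ?ltW // ltr_pdivrMr ?mul1r.
move=> /cvgr0_norm_lt /(_ _ c0) [k _ /(_ k (leqnn k)) /=].
move=> /(le_lt_trans (ler_norm _)); rewrite ltNge => /negP; apply.
by rewrite expr_div_n mulrAC ler_pdivlMr ?exprn_gt0 // mulrC [_ * C]mulrC.
Qed.

(** With m = [t.+1] this is (1 + 1/m)^m <= e, which follows from 1 + y <= e^y at y = 1/m. *)
Lemma expRN1_le (R : realType) (t : nat) :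
  expR (- 1) <= (t.+1%:R / t.+2%:R) ^+ t.+1 :> R.
Proof.
have t0 : (0 : R) < t.+1%:R by rewrite ltr0n.
have -> : - 1 = t.+1%:R * (- t.+1%:R^-1) :> R by rewrite mulrN divff ?gt_eqF.
rewrite expRM_natl lerXn2r ?nnegrE ?expR_ge0 ?divr_ge0 ?ler0n //.
rewrite expRN -[leRHS]invrK lef_pV2 ?posrE ?expR_gt0 ?invr_gt0 ?divr_gt0 ?ltr0n //.
rewrite invf_div; apply: le_trans (expR_ge1Dx _).
by rewrite -[t.+2]addn1 natrD mulrDl divff ?gt_eqF // div1r.
Qed.

Lemma poincare_of_mixing (R : realType) (n : nat) (P : 'M[R]_n.+1)
    (pi : 'rV[R]_n.+1) (t : nat) (u : 'cV[R]_n.+1) :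
  stochastic P -> stationary P pi -> reversible P pi ->
  (forall x, tvd (row x (P ^+ t)) pi <= expR (- 1) / 2) -> pi *m u = 0 ->
  dotpi R n pi u u *+ 2 <= t.+1%:R * dirichlet R n P pi u.
Proof.
move=> stoP stP rev mix u0; have [pi0 pi1 _] := stP.
pose b j := dotpi R n pi (P ^+ j *m u) (P ^+ j *m u).
have b_ge0 j : 0 <= b j by apply: dotpi_ge0.
have b0E : b 0%N = dotpi R n pi u u by rewrite /b expr0 mul1mx.
have D0 := dirichlet_ge0 R n P pi u stoP pi0.
have := b_ge0 0%N; rewrite le_eqVlt => /predU1P[b00|b0_gt0].
  by rewrite -b0E -b00 mul0rn mulr_ge0.
have shift j : P ^+ j.+1 *m u = P *m (P ^+ j *m u).
  by rewrite exprS -mulmxE mulmxA.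
have lc j : b j.+1 ^+ 2 <= b j * b j.+2.
  (* Self-adjointness moves one factor [P] across the product, so that Cauchy-Schwarz separates [j]
     from [j.+2]. *)
  have -> : b j.+1 = dotpi R n pi (P ^+ j *m u) (P ^+ j.+2 *m u).
    by rewrite /b (shift j.+1) -(dotpi_self_adjoint R n P) // -shift.
  exact: dotpi_CS.
have growth := log_convex_growth R b b_ge0 lc.
pose M := \sum_x `|u x 0|.
have uM x : `|u x 0| <= M.
  by rewrite /M (bigD1 x) //= lerDl sumr_ge0.
(* Every [t] steps shrink the sup norm by e^(-1), and the sup norm dominates the L^2(pi) norm
   because pi has mass 1. *)
have decay k : b (k * t)%N <= M ^+ 2 * (expR (- 1) ^+ 2) ^+ k.
  have sup x : `|(P ^+ (k * t) *m u) x 0| <= expR (- 1) ^+ k * M.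
    elim: k x => [|k IH] x; first by rewrite !expr0 mul1mx mul1r.
    rewrite mulSn exprD -mulmxE -mulmxA exprS -mulrA.
    by apply: (sup_contract R n P pi) => //; apply: mean0_expr.
  rewrite -exprM [(2 * k)%N]mulnC exprM -exprMn [M * _]mulrC -[leRHS]mul1r -[X in _ <= X * _]pi1.
  rewrite mulr_suml.
  apply: ler_sum => x _; rewrite -mulrA ler_wpM2l // -expr2 -real_normK ?num_real //.
  by rewrite lerXn2r ?nnegrE ?normr_ge0 ?sup ?(le_trans (normr_ge0 _) (sup x)).
have rate : b 1%N ^+ t <= b 0%N ^+ t * expR (- 1) ^+ 2.
  apply: (geometric_rate_le _ _ _ (b 0%N) (M ^+ 2)) => // [|k].
    by rewrite mulr_gt0 ?exprn_gt0 ?expR_gt0.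
  rewrite -exprM mulnC; apply: le_trans (growth _) _.
  rewrite exprMn -exprM [(t * k)%N]mulnC [leRHS]mulrCA.
  apply: ler_wpM2l; [exact: exprn_ge0|].
  exact: decay.
(* At t = 0, [rate] would read 1 <= e^(-2). From here on the mixing time is written [t.+1]. *)
case: t => [|t] in mix decay rate *.
  exfalso; move: rate; rewrite !expr0 mul1r leNgt expr_lt1 ?expR_ge0 //.
  by rewrite expR_lt1 oppr_lt0 ltr01.
pose s : R := t.+1%:R / t.+2%:R.
have s0 : 0 <= s by rewrite divr_ge0 ?ler0n.
have b1_le : b 1%N <= b 0%N * s ^+ 2.
  rewrite -(@ler_pXn2r _ t.+1) ?nnegrE ?mulr_ge0 ?exprn_ge0 //.
  apply: le_trans rate _; rewrite exprMn ler_wpM2l ?exprn_ge0 //.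
  rewrite exprAC lerXn2r ?nnegrE ?expR_ge0 ?exprn_ge0 //; exact: expRN1_le.
have cross : dotpi R n pi u (P *m u) <= b 0%N * s.
  apply: le_trans (ler_norm _) _; rewrite -(@ler_pXn2r _ 2) ?nnegrE ?mulr_ge0 //.
  rewrite real_normK ?num_real // exprMn; apply: le_trans (dotpi_CS R n pi u _ pi0) _; rewrite -b0E expr2 -mulrA.
  by rewrite ler_wpM2l //; move: b1_le; rewrite /b expr1.
rewrite dirichletE // -b0E -[leLHS]mulr_natl mulrCA ler_pM2l ?ltr0n //.
(* Because 1 - s = 1 / [t.+2], the factor in the goal exactly cancels the gap left by [cross]. *)
rewrite [leLHS](_ : b 0%N = t.+2%:R * (b 0%N - b 0%N * s)); last first.
  rewrite /s; field; by rewrite -natrD pnatr_eq0.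
by rewrite ler_pM2l ?ltr0n // lerB.
Qed.

(** * Comparison of Dirichlet forms through a flow *)

Lemma sum_path_edges (R : zmodType) (n : nat) (u : 'I_n.+1 -> R) x p :
  \sum_(e <- path_edges (x :: p)) (u e.1 - u e.2) = u x - u (last x p).
Proof.
elim: p x => [|y p IH] x; first by rewrite big_nil subrr.
have -> : path_edges [:: x, y & p] = (x, y) :: path_edges (y :: p) by [].
rewrite big_cons IH /=.
by rewrite addrA subrK.
Qed.

Lemma big_count_mem (R : pzSemiRingType) (T : finType) (s : seq T) (F : T -> R) :
  \sum_(e <- s) F e = \sum_e (count_mem e s)%:R * F e.
Proof.
elim: s => [|a s IH]; first by rewrite big_nil big1 // => e _; rewrite mul0r.
rewrite big_cons IH; under [RHS]eq_bigr => e _ do rewrite /= natrD mulrDl.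
rewrite big_split /=; congr (_ + _).
rewrite (bigD1 a) //= eqxx mul1r big1 ?addr0 // => e /negPf.
by rewrite eq_sym => ->; rewrite mul0r.
Qed.

Section Flow.
Variables (R : realType) (n : nat) (P P' : 'M[R]_n.+1).

(** Telescope along the path, then apply Cauchy-Schwarz with unit weights; the sum of the ones is
    the length. Edges are grouped by multiplicity to match the congestion. *)
Lemma sqr_diff_le_path (u : 'I_n.+1 -> R) x y g : is_path P x y g ->
  (u x - u y) ^+ 2 <=
    (path_len g)%:R * \sum_e (occ e g)%:R * (u e.1 - u e.2) ^+ 2.
Proof.
case: g => // z p /and4P[/eqP-> /eqP<- _ _].
rewrite -(sum_path_edges R _ u) /occ -(big_count_mem R _ _ (fun e => (u e.1 - u e.2) ^+ 2)).
have := sqr_sum_le R _ (path_edges (x :: p)) (fun=> 1) (fun=> 1)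
  (fun e => u e.1 - u e.2) (fun=> ler01).
under eq_bigr do rewrite !mul1r.
under [X in X * _]eq_bigr do rewrite mul1r expr1n.
under [X in _ * X]eq_bigr do rewrite mul1r.
rewrite big_const_seq count_predT iter_addr_0.
by rewrite /path_edges size_zip /= minnC (minn_idPl (leqnSn _)).
Qed.

Lemma in_pathsI x y g : 0 < P' x y -> is_path P x y g -> in_paths P P' g.
Proof.
move=> P'xy xyP; rewrite /in_paths.
by apply/existsP; exists x; apply/existsP; exists y; rewrite P'xy.
Qed.

(** A path determines its endpoints, so the path sets of distinct pairs are disjoint and no path is
    counted twice. *)
Lemma sum_is_path (F : seq 'I_n.+1 -> R) :
  \sum_x \sum_(y | 0 < P' x y) sum_paths (is_path P x y) F =
  sum_paths (in_paths P P') F.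
Proof.
rewrite /sum_paths pair_big_dep /= exchange_big; apply: eq_bigr => k _ /=.
under eq_bigr do rewrite big_mkcond.
rewrite exchange_big [RHS]big_mkcond; apply: eq_bigr => t _ /=.
case: ifP => [/existsP[x /existsP[y /andP[P'xy xyP]]]|notP].
  rewrite (bigD1 (x, y)) //= xyP big1 ?addr0 // => -[x' y'] /andP[_ neq] /=.
  case: ifP => // xyP'; case/negP: neq; apply/eqP; move: xyP xyP'.
  by case: (tval t) => // z p /and4P[/eqP<- /eqP<- _ _] /and4P[/eqP<- /eqP<- _ _].
apply: big1 => -[x y] /= P'xy; case: ifP => // xyP.
by rewrite (in_pathsI _ _ _ P'xy xyP) in notP.
Qed.

(** The flow condition spreads each pi(x) P'(x,y) over paths. After exchanging the sums, each edge
    of [P] carries its weight pi(z) P(z,w) times its congestion. *)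
Lemma flow_dirichlet_le (pi : 'rV[R]_n.+1) f (u : 'cV[R]_n.+1) :
  stochastic P -> stochastic P' -> (forall x, 0 < pi 0 x) ->
  is_flow P P' pi f ->
  dirichlet R n P' pi u <= congestion P P' pi f * dirichlet R n P pi u.
Proof.
move=> [P0 _] [P'0 _] pi_gt0 [f01 f_flow].
pose d (e : 'I_n.+1 * 'I_n.+1) := (u e.1 0 - u e.2 0) ^+ 2.
pose G g := f g * ((path_len g)%:R * \sum_e (occ e g)%:R * d e).
apply: (@le_trans _ _ (sum_paths (in_paths P P') G)).
  rewrite -sum_is_path; apply: ler_sum => x _.
  rewrite [leRHS]big_mkcond; apply: ler_sum => y _; case: ifP => P'xy; last first.
    by have := P'0 x y; rewrite le_eqVlt P'xy orbF => /eqP<-; rewrite mulr0 mul0r.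
  rewrite -(f_flow x y P'xy) /sum_paths mulr_suml; apply: ler_sum => k _.
  rewrite mulr_suml; apply: ler_sum => t xyP; apply: ler_wpM2l.
    by have /f01/andP[] := in_pathsI _ _ _ P'xy xyP.
  exact: (sqr_diff_le_path (u^~ 0)).
have -> : sum_paths (in_paths P P') G = \sum_e d e *
    sum_paths (in_paths P P')
      (fun g => (occ e g)%:R * (path_len g)%:R * f g).
  under [RHS]eq_bigr do rewrite mulr_sumr.
  rewrite exchange_big; apply: eq_bigr => k _.
  under [RHS]eq_bigr do rewrite mulr_sumr.
  rewrite exchange_big; apply: eq_bigr => t _ /=; rewrite /G !mulr_sumr.
  by apply: eq_bigr => e _; ring.
rewrite /dirichlet pair_big /= mulr_sumr; apply: ler_sum => e _.
have := P0 e.1 e.2; rewrite le_eqVlt => /predU1P[Pe|Pe]; last first.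
  rewrite mulrA mulrC ler_wpM2r ?sqr_ge0 //.
  have w0 : 0 < pi 0 e.1 * P e.1 e.2 by rewrite mulr_gt0.
  rewrite -ler_pdivrMr // mulrC; apply: le_trans (le_bigmax_cond _ _ _); last exact: Pe.
  by [].
(* An edge outside E*(M) lies on no path, so its occurrence count is 0. *)
rewrite -Pe mulr0 mul0r mulr0 [X in _ * X]big1 ?mulr0 // => k _; apply: big1 => t.
case/existsP=> x /existsP[y /andP[_]].
case: (tval t) => // z p /and4P[_ _ /allP edges _].
suff -> : occ e (z :: p) = 0%N by rewrite !mul0r.
by apply/count_memPn/negP => /edges; rewrite -Pe ltxx.
Qed.

End Flow.

(** * Differentiating the matrix exponential entrywise *)

Section MatrixExponential.
Variables (R : realType) (n : nat) (A : 'M[R]_n.+1).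

Lemma expr_entry_bound :
  exists2 K : R, 0 <= K & forall k i j, `|(A ^+ k) i j| <= K ^+ k.
Proof.
(* The sum of the absolute values of all entries dominates each row sum, which is what the induction
   needs. *)
exists (\sum_i \sum_j `|A i j|); first by do 2![apply: sumr_ge0 => ? _].
elim=> [|k IH] i j; first by rewrite !expr0 mxE; case: (i == j); rewrite ?normr1 ?normr0.
set K := \sum_i _ in IH *.
rewrite exprS -mulmxE mxE; apply: le_trans (ler_norm_sum _ _ _) _.
apply: (@le_trans _ _ ((\sum_l `|A i l|) * K ^+ k)).
  by rewrite mulr_suml; apply: ler_sum => l _; rewrite normrM ler_wpM2l.
rewrite exprS ler_wpM2r //.
  by apply: exprn_ge0; do 2![apply: sumr_ge0 => ? _].
by rewrite /K [leRHS](bigD1 i) //= lerDl; do 2![apply: sumr_ge0 => ? _].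
Qed.

(** Comparison with an exponential series. It serves the entry series and its first two derived
    series, as termwise differentiation requires. *)
Lemma is_cvg_pseries_le_fact (c : nat -> R) (C K : R) : 0 <= K -> 0 <= C ->
  (forall k, `|c k| <= C * K ^+ k / k`!%:R) -> forall t, cvgn (pseries c t).
Proof.
move=> K0 C0 cK t; apply: normed_cvg.
apply: (@series_le_cvg _ _ (C *: exp_coeff (K * `|t|))).
- by move=> k; apply: normr_ge0.
- by move=> k; apply: mulr_ge0 => //; apply: exp_coeff_ge0; rewrite mulr_ge0.
- move=> k; rewrite /= normrM normrX.
  apply: le_trans (ler_wpM2r (exprn_ge0 _ (normr_ge0 t)) (cK k)) _.
  have -> : (C *: exp_coeff (K * `|t|)) k = C * ((K * `|t|) ^+ k / k`!%:R) by [].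
  by rewrite exprMn le_eqVlt; apply/orP; left; apply/eqP; ring.
- by apply: is_cvg_seriesZ; apply: is_cvg_series_exp_coeff.
Qed.

Let c i j k : R := (A ^+ k) i j / k`!%:R.

Let diffs_c i j k : pseries_diffs (c i j) k = (A ^+ k.+1) i j / k`!%:R.
Proof.
rewrite /pseries_diffs /c factS natrM invfM mulrCA !mulrA mulfK ?pnatr_eq0 //.
Qed.

Let cvg_c i j t : cvgn (pseries (c i j) t).
Proof.
have [K K0 AK] := expr_entry_bound.
apply: (@is_cvg_pseries_le_fact _ 1 K) => // k.
by rewrite normrM normfV normr_nat mul1r ler_wpM2r ?invr_ge0.
Qed.

Lemma mexpE t i j : mexp (t *: A) i j = limn (pseries (c i j) t).
Proof.
rewrite mxE; congr (limn (series _)); apply/funext => k.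
by rewrite /= exprZn mxE /c; ring.
Qed.

Lemma mexp0 : mexp (0 *: A) = 1%:M.
Proof.
apply/matrixP => i j; rewrite mexpE; apply/(@cvg_lim _) => //.
apply: cvg_near_cst; exists 1%N => // -[//|k] _.
rewrite /pseries /series /= big_nat_recl // big1 => [|l _]; last first.
  by rewrite expr0n mulr0.
by rewrite /c !expr0 fact0 divr1 mulr1 addr0.
Qed.

Lemma is_derive_mexp (t : R) i j :
  is_derive t (1 : R) (fun s : R => mexp (s *: A) i j) ((mexp (t *: A) *m A) i j).
Proof.
have -> : (fun s => mexp (s *: A) i j) = (fun s => limn (pseries (c i j) s)).
  by apply/funext => s; rewrite mexpE.
have -> : (mexp (t *: A) *m A) i j = limn (pseries (pseries_diffs (c i j)) t).
  apply/esym/cvg_lim => //; rewrite mxE.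
  under eq_bigr do rewrite mexpE.
  have -> : pseries (pseries_diffs (c i j)) t =
      (fun m => \sum_l pseries (c i l) t m * A l j).
    apply/funext => m; rewrite /pseries /series /=.
    under [RHS]eq_bigr do rewrite mulr_suml.
    rewrite exchange_big /=; apply: eq_bigr => k _.
    rewrite diffs_c exprSr -mulmxE mxE !mulr_suml; apply: eq_bigr => l _.
    by rewrite /c; ring.
  apply: cvg_big => [|l _]; first exact: add_continuous.
  by apply: cvgM; [apply: cvg_c|apply: cvg_cst].
have [K K0 AK] := expr_entry_bound.
(* Any point strictly beyond [|t|] would do for the convergence conditions. *)
apply: (@pseries_snd_diffs _ _ (`|t| + 1)).
- exact: cvg_c.
- apply: (@is_cvg_pseries_le_fact _ K K) => // k.
  by rewrite diffs_c normrM normfV normr_nat -exprS ler_wpM2r ?invr_ge0.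
- apply: (@is_cvg_pseries_le_fact _ (K ^+ 2) K) => // [|k]; first by rewrite exprn_ge0.
  have -> : pseries_diffs (pseries_diffs (c i j)) k = (A ^+ k.+2) i j / k`!%:R.
    rewrite {1}/pseries_diffs diffs_c factS natrM.
    by field; rewrite nat1r !pnatr_eq0 -lt0n fact_gt0.
  by rewrite normrM normfV normr_nat -exprD ler_wpM2r ?invr_ge0.
- by rewrite [ltRHS]ger0_norm ?addr_ge0 ?ler01 // ltrDl ltr01.
Qed.

End MatrixExponential.

(** * Exponential decay of the continuous-time density *)

Lemma gronwall_decay (R : realType) (f df : R -> R) (a : R) :
  (forall t, is_derive t (1 : R) f (df t)) -> (forall t, df t <= - a * f t) ->
  forall t, 0 <= t -> f t <= expR (- (a * t)) * f 0.
Proof.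
move=> f_df df_le t t0.
(* The integrating factor: e^(a t) f(t) has nonpositive derivative. *)
pose g := (expR \o (a \*: (@id R))) * f.
have dg s : is_derive s (1 : R) g (expR (a * s) * (a * f s + df s)).
  have d_exp : is_derive s (1 : R) (expR \o (a \*: @id R)) (expR (a * s) * (a * 1)).
    exact: is_derive1_comp (is_derive_expR _) (is_deriveZ a (is_derive_id s 1)).
  apply: is_derive_eq (is_deriveM d_exp (f_df s)) _.
  by rewrite /= /GRing.scale /=; ring.
have gt : g t <= g 0.
  apply: (@ler0_derive1_le_cc _ g 0 t) => //; rewrite ?in_itv /= ?lexx ?t0 //.
  - move=> s _; rewrite derive1E (@derive_val _ _ _ _ _ _ _ (dg s)).
    by rewrite pmulr_rle0 ?expR_gt0 // addrC -lerBrDr sub0r -mulNr.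
  - by apply: derivable_within_continuous => s _.
move: gt; rewrite /g /= !fctE /=.
have -> : a *: t = a * t by [].
have -> : a *: (0 : R) = 0 by rewrite scaler0.
rewrite expR0 mul1r => le_f0.
by rewrite expRN [leRHS]mulrC ler_pdivlMr ?expR_gt0 // mulrC.
Qed.

(** The derivative of the row sum is a combination of the row sums of [A], hence 0, and the value at
    time 0 is 1. *)
Lemma sum_row_mexp (R : realType) (n : nat) (A : 'M[R]_n.+1) x (t : R) :
  (forall y, \sum_z A y z = 0) -> \sum_y mexp (t *: A) x y = 1.
Proof.
move=> A0.
have der s : is_derive s (1 : R) (\sum_y (fun r : R => mexp (r *: A) x y)) 0.
  apply: is_derive_eq (is_derive_sum (fun y => is_derive_mexp R n A s x y)) _.
  under eq_bigr do rewrite mxE.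
  rewrite exchange_big big1 // => y _.
  by rewrite -mulr_sumr A0 mulr0.
have := is_derive_0_is_cst t 0 der; rewrite !fct_sumE => ->.
rewrite mexp0; under eq_bigr do rewrite mxE.
by rewrite (bigD1 x) //= eqxx big1 ?addr0 // => y /negPf; rewrite eq_sym => ->.
Qed.

Section ContinuousDecay.
Variables (R : realType) (n : nat) (P : 'M[R]_n.+1) (pi : 'rV[R]_n.+1).
Hypotheses (stoP : stochastic P) (stP : stationary P pi).
Hypothesis pi_gt0 : forall x, 0 < pi 0 x.
Variable x : 'I_n.+1.
Let Q := P - 1%:M.

Definition density (t : R) : 'cV[R]_n.+1 :=
  \col_y ((mexp (t *: Q) x y - pi 0 y) / pi 0 y).

Let Q_row0 y : \sum_z Q y z = 0.
Proof.
have [_ P1] := stoP; under eq_bigr do rewrite !mxE.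
rewrite sumrB P1 (bigD1 y) //= eqxx big1 ?addr0 ?subrr // => z /negPf.
by rewrite eq_sym => ->.
Qed.

Let density_entry t y : density t y 0 = (mexp (t *: Q) x y - pi 0 y) / pi 0 y.
Proof. by rewrite mxE. Qed.

Let densityE t y : pi 0 y * density t y 0 = mexp (t *: Q) x y - pi 0 y.
Proof. by rewrite density_entry mulrC divfK ?gt_eqF. Qed.

Lemma density_mean0 t : pi *m density t = 0.
Proof.
apply/matrixP => i j; rewrite !ord1 !mxE.
under eq_bigr do rewrite densityE.
by have [_ pi1 _] := stP; rewrite sumrB sum_row_mexp // pi1 subrr.
Qed.

Lemma is_derive_dotpi_density t :
  is_derive t (1 : R) (fun s => dotpi R n pi (density s) (density s))
    (- dirichlet R n P pi (density t)).
Proof.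
have -> : (fun s => dotpi R n pi (density s) (density s)) =
    \sum_y ((pi 0 y)^-1 \*: ((fun s : R => mexp (s *: Q) x y) - cst (pi 0 y)) ^+ 2).
  apply/funext => s; rewrite fct_sumE; apply: eq_bigr => y _.
  rewrite densityE density_entry !fctE mulrA -expr2.
  exact: mulrC.
have := is_derive_sum (fun y : 'I_n.+1 => is_deriveZ (pi 0 y)^-1
  (is_deriveX 2 (is_deriveB (is_derive_mexp R n Q t x y) (is_derive_cst (pi 0 y) t 1)))).
move=> /is_derive_eq; apply.
rewrite dirichletE // -mulrN opprB.
have -> : dotpi R n pi (density t) (P *m density t) - dotpi R n pi (density t) (density t) =
    dotpi R n pi (density t) (Q *m density t).
  by rewrite /Q mulmxBl mul1mx -sumrB; apply: eq_bigr => y _; rewrite !mxE mulrBr.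
(* Here pi times the density is the row of exp(tQ) minus pi, and the pi part drops out because pi Q
   = 0. *)
have -> : dotpi R n pi (density t) (Q *m density t) =
    \sum_y (mexp (t *: Q) *m Q) x y * density t y 0.
  rewrite /dotpi; under eq_bigr do rewrite densityE [(Q *m _) _ _]mxE mulr_sumr.
  rewrite exchange_big /=; apply: eq_bigr => y _.
  under eq_bigr do rewrite mulrA.
  rewrite -mulr_suml; congr (_ * _); rewrite [RHS]mxE.
  under eq_bigr do rewrite mulrBl.
  rewrite sumrB -[RHS]subr0; congr (_ - _).
  have [_ _ piP] := stP; have : pi *m Q = 0 by rewrite mulmxBr mulmx1 piP subrr.
  by move/matrixP/(_ 0 y); rewrite !mxE.
rewrite mulr_sumr; apply: eq_bigr => y _.
rewrite density_entry !fctE subr0 expr1.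
set m := mexp (t *: Q) x y; set m' := (_ *m _) x y.
transitivity ((pi 0 y)^-1 * (2 * (m - pi 0 y) * m')); [by [] | ring].
Qed.

Lemma tvd_mexp_le (C t : R) : 0 < C -> 0 <= t ->
  (forall u, pi *m u = 0 -> 2 * dotpi R n pi u u <= C * dirichlet R n P pi u) ->
  (2 * tvd (row x (mexp (t *: Q))) pi) ^+ 2 <= expR (- (2 / C * t)) / pi 0 x.
Proof.
move=> C0 t0 poincare; have [pi0 pi1 _] := stP.
(* Twice the variation distance is the L^1(pi) norm of the density, at most its L^2(pi) norm since
   pi has mass 1. *)
apply: (@le_trans _ _ (dotpi R n pi (density t) (density t))).
  rewrite /tvd mulrA divff ?pnatr_eq0 // mul1r.
  have -> : \sum_y `|row x (mexp (t *: Q)) 0 y - pi 0 y| =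
      \sum_y pi 0 y * 1 * `|density t y 0|.
    apply: eq_bigr => y _.
    by rewrite mulr1 mxE -densityE normrM ger0_norm.
  apply: le_trans (sqr_sum_le R _ _ (pi 0) (fun=> 1) (fun y => `|density t y 0|) pi0) _.
  under eq_bigr do rewrite expr1n mulr1.
  rewrite pi1 mul1r; apply: ler_sum => y _.
  by rewrite real_normK ?num_real // expr2 mulrA.
apply: le_trans (gronwall_decay _ _ _ (2 / C) is_derive_dotpi_density _ t t0) _.
  move=> s; rewrite mulNr lerN2 mulrAC ler_pdivrMr //.
  by rewrite [leRHS]mulrC; apply: poincare; apply: density_mean0.
apply: ler_wpM2l; first exact: expR_ge0.
(* The chi-square distance from a point mass at x to pi; the -1 is then dropped. *)
have -> : dotpi R n pi (density 0) (density 0) = (pi 0 x)^-1 - 1.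
  have -> : dotpi R n pi (density 0) (density 0) =
      \sum_y ((x == y)%:R / pi 0 y - (x == y)%:R *+ 2 + pi 0 y).
    apply: eq_bigr => y _; rewrite densityE density_entry mexp0 mxE.
    by case: (x == y) => /=; field; rewrite gt_eqF.
  rewrite big_split /= pi1 sumrB (bigD1 x) //= eqxx [X in _ + X - _]big1; last first.
    by move=> y /negPf; rewrite eq_sym => ->; rewrite mul0r.
  rewrite [X in _ - X](bigD1 x) //= eqxx [X in _ - (_ + X)]big1; last first.
    by move=> y /negPf; rewrite eq_sym => ->; rewrite mul0rn.
  by rewrite mulr1n; ring.
by rewrite gerBl ler01.
Qed.

End ContinuousDecay.

(** * From decay to the bound on the continuous mixing time *)

Lemma ctau_x_le (R : realType) (n : nat) (P : 'M[R]_n.+1) (pi : 'rV[R]_n.+1) x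
    (eps T : R) : 0 < T ->
  (forall t, T <= t -> tvd (row x (mexp (t *: (P - 1%:M)))) pi <= eps) ->
  ctau_x P pi x eps <= T.
Proof. by move=> T0 mix; apply: ge_inf; [exists 0 => s [/ltW] | split]. Qed.

Theorem theorem26 (R : realType) (n : nat) (P P' : 'M[R]_n.+1)
  (pi : 'rV[R]_n.+1) (f : seq 'I_n.+1 -> R) (eps : R) (x : 'I_n.+1) :
  ergodic P -> stationary P pi ->
  ergodic P' -> stationary P' pi -> reversible P' pi ->
  is_flow P P' pi f ->
  0 < eps -> eps ^+ 2 * pi 0 x <= 1 ->
  ctau_x P pi x eps <=
    congestion P P' pi f / 2 * (tau P' pi (1 / (2 * expR 1)) + 1)
    * ln (1 / (eps ^+ 2 * pi 0 x)).
Proof.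
move=> ergP stP ergP' stP' rev flow eps0 small.
have [stoP _ _] := ergP; have [stoP' _ _] := ergP'; have [pi0 _ _] := stP.
have pi_gt0 y := stationary_gt0 R n P pi y ergP stP.
set A := congestion _ _ _ _; set eta := 1 / (2 * expR 1); set L := ln _.
have A0 : 0 <= A by apply: bigmax_ge_id.
have etaE : eta = expR (- 1) / 2 by rewrite /eta expRN mul1r invfM mulrC.
have eta0 : 0 < eta by rewrite etaE divr_gt0 ?expR_gt0.
have [t t_le mix] := tau_attained R n P' pi eta
  (reversible_mixing R n P' pi eta ergP' stP' rev eta0).
have w0 : 0 < eps ^+ 2 * pi 0 x by rewrite mulr_gt0 ?exprn_gt0.
have L0 : 0 <= L by rewrite /L ln_ge0 // div1r invf_ge1.
pose C := A * (tau P' pi eta + 1).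
have C0 : 0 <= C by rewrite mulr_ge0 // addr_ge0 // (le_trans _ t_le).
have poincare u : pi *m u = 0 -> 2 * dotpi R n pi u u <= C * dirichlet R n P pi u.
  move=> u0; rewrite mulr_natl.
  apply: le_trans (poincare_of_mixing R n P' pi t u stoP' stP' rev _ u0) _.
    by move=> y; rewrite -etaE.
  rewrite /C [A * _]mulrC -mulrA; apply: ler_pM.
  - by [].
  - exact: dirichlet_ge0.
  - by rewrite -natr1 lerD2r.
  - exact: flow_dirichlet_le.
(* [C] vanishes when there is only one state, hence the perturbation by [d]. *)
have bound d : 0 < d -> ctau_x P pi x eps <= (C + d) / 2 * L + d.
  move=> d0; have Cd0 : 0 < C + d by rewrite ltr_wpDl.
  (* The final [d] keeps this time positive even when [L] is 0. *)
  have T0 : 0 < (C + d) / 2 * L + d by rewrite ltr_wpDl // mulr_ge0 // divr_ge0 // ltW.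
  apply: ctau_x_le => // s sT.
  have s0 := ltW (lt_le_trans T0 sT).
  have L_le : L <= 2 / (C + d) * s.
    rewrite -invf_div mulrC ler_pdivlMr ?divr_gt0 // mulrC.
    by apply: le_trans sT; rewrite lerDl ltW.
  have := tvd_mexp_le R n P pi stoP stP pi_gt0 x (C + d) s Cd0 s0.
  have poincare' u : pi *m u = 0 -> 2 * dotpi R n pi u u <= (C + d) * dirichlet R n P pi u.
    move=> /poincare /le_trans; apply; rewrite ler_wpM2r ?dirichlet_ge0 //.
    by rewrite lerDl ltW.
  move=> /(_ poincare') tvd_le.
  have tvd0 : 0 <= tvd (row x (mexp (s *: (P - 1%:M)))) pi.
    by rewrite mulr_ge0 // sumr_ge0.
  (* Even twice the variation distance is at most [eps], which is how [eps ^+ 2] enters the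
     logarithm. *)
  apply: (@le_trans _ _ (2 * tvd (row x (mexp (s *: (P - 1%:M)))) pi)).
    by rewrite ler_peMl ?ler1n.
  rewrite -(@ler_pXn2r _ 2) ?nnegrE ?(ltW eps0) ?(mulr_ge0 _ tvd0) //.
  apply: le_trans tvd_le _; rewrite ler_pdivrMr //.
  apply: (@le_trans _ _ (expR (- L))); first by rewrite ler_expR lerN2.
  by rewrite /L expRN lnK ?posrE ?divr_gt0 // div1r invrK.
rewrite -[leRHS]/(A / 2 * (tau P' pi eta + 1) * L).
have -> : A / 2 * (tau P' pi eta + 1) * L = C / 2 * L by rewrite /C; ring.
(* With d = e / (L/2 + 1) the excess d L/2 + d is exactly [e]. *)
apply/ler_addgt0Pr => e e0; have L2 : 0 < L / 2 + 1 by rewrite ltr_wpDl ?divr_ge0.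
apply: le_trans (bound (e / (L / 2 + 1)) _) _; first by rewrite divr_gt0.
rewrite le_eqVlt; apply/orP; left; apply/eqP.
by field; rewrite gt_eqF // ltr_wpDl.
Qed.
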